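(* Let $\mathcal H$ be a real Hilbert space, let $V$ be a closed vector subspace of $\mathcal H$, let $A\colon\mathcal H\to 2^{\mathcal H}$ be maximally monotone, let $\beta\in\,]0,+\infty[$, and let $B\colon\mathcal H\to\mathcal H$ be $\beta$-cocoercive in $V$. Let $Z=\{x\in\mathcal H\mid 0\in Ax+Bx+N_Vx\}$ and suppose that $Z\neq\varnothing$. Let $\gamma\in\,]0,+\infty[$, let $\varepsilon\in\,]0,\max\{1,\beta/\gamma\}[$, let $(\delta_n)_{n\in\mathbb N}$ be a sequence in $[\varepsilon,(2\beta/\gamma)-\varepsilon]$, and let $(\lambda_n)_{n\in\mathbb N}$ be a sequence in $[\varepsilon,1]$. Let $x_0\in V$, let $y_0\in V^\bot$, and let $(x_n)_{n\in\mathbb N}$, $(y_n)_{n\in\mathbb N}$ be generated by the following routine, for every $n\in\mathbb N$. Step 1. Find $(p_n,q_n)\in\mathcal H^2$ such that $$x_n-\delta_n\gamma P_VBx_n+\gamma y_n=p_n+\gamma q_n\quad\text{and}\quad \frac{P_Vq_n}{\delta_n}+P_{V^\bot}q_n\in A\Big(P_Vp_n+\frac{P_{V^\bot}p_n}{\delta_n}\Big).$$ Step 2. Set $x_{n+1}=x_n+\lambda_n(P_Vp_n-x_n)$ and $y_{n+1}=y_n+\lambda_n(P_{V^\bot}q_n-y_n)$, and go to Step 1. Then the sequences $(x_n)_{n\in\mathbb N}$ and $(y_n)_{n\in\mathbb N}$ are in $V$ and $V^\bot$, respectively, and there exist $\overline x\in Z$ and $\overline y\in V^\bot\cap(A\overline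 x+P_VB\overline x)$ such that the following hold. (i) $x_n\rightharpoonup\overline x$ and $y_n\rightharpoonup\overline y$. (ii) $x_{n+1}-x_n\to0$ and $y_{n+1}-y_n\to0$. (iii) $P_VBx_n\to P_VB\overline x$.
   Context: $B$ is $\beta$-cocoercive in $V$ means: for all $x,y\in V$, $\langle x-y\mid Bx-By\rangle\ge\beta\|Bx-By\|^2$. $P_V$ and $P_{V^\bot}$ are the orthogonal projections onto $V$ and onto its orthogonal complement $V^\bot$, and $N_V$ is the normal cone operator: $N_Vx=V^\bot$ if $x\in V$ and $N_Vx=\varnothing$ otherwise. $\rightharpoonup$ and $\to$ denote weak and strong convergence, respectively. *)

(* Defs.v *)
From HB Require Import structures.
From mathcomp Require Export all_boot all_order all_algebra.
From mathcomp Require Export all_classical all_reals all_analysis.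
Export Order.TTheory GRing.Theory Num.Theory.
Export numFieldNormedType.Exports.

Set Implicit Arguments.
Unset Strict Implicit.
Unset Printing Implicit Defensive.

#[global] Open Scope classical_set_scope.
#[global] Open Scope ring_scope.

(* A real Hilbert space is a complete normed space [H] over a real field [R],
   together with a positive definite symmetric bilinear form
   [dot : {dot H for idfun}] that induces the norm of [H]. *)
Definition induces_norm (R : realType) (H : completeNormedModType R)
    (dot : {dot H for idfun}) : Prop :=
  forall x : H, `|x| ^+ 2 = dot x x.

Definition closed_subspace (R : realType) (H : completeNormedModType R)
    (V : set H) : Prop :=
  submod_closed (mem V) /\ closed V.

Section HilbertDefs.
Context (R : realType) (H : completeNormedModType R) (dot : {dot H for idfun}).
(* Set-valued operators [H -> 2^H] are functions [H -> set H]. *)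
Implicit Types (V : set H) (A : H -> set H) (B : H -> H).

Definition orth V : set H := [set u | forall v, V v -> dot u v = 0].

(* The default value [0] is never used when [V] is a closed subspace. *)
Definition proj V (x : H) : H :=
  xget 0 [set p | V p /\ orth V (x - p)].

Definition normal_cone V (x : H) : set H :=
  [set u | V x /\ orth V u].

(* Solutions of [0 \in A x + B x + N_V x], with the sum of sets taken elementwise;
   in particular it is empty when [x] is not in [V]. *)
Definition solutions V A B : set H :=
  [set x | [set a + B x + u | a in A x & u in normal_cone V x] 0].

Definition monotone A : Prop :=
  forall x y u v, A x u -> A y v -> 0 <= dot (x - y) (u - v).

(* No monotone operator has a graph that properly contains that of [A]. *)
Definition maximally_monotone A : Prop :=
  monotone A /\
  forall A', monotone A' -> (forall x, A x `<=` A' x) ->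
    forall x, A' x `<=` A x.

Definition cocoercive_in V (beta : R) B : Prop :=
  forall x y, V x -> V y ->
    beta * `|B x - B y| ^+ 2 <= dot (x - y) (B x - B y).

Definition weak_cvg (u : nat -> H) (l : H) : Prop :=
  forall z : H, dot (u n) z @[n --> \oo] --> dot l z.

End HilbertDefs.

(* Main.v *)
Require Import Defs.
From mathcomp Require Import ring lra.

(** The algorithm is a forward-backward iteration in disguise. Write [P] and
[Q] for the projections onto [V] and onto its orthogonal complement, and put
[s n = x n + gamma *: y n]. A vector [s = x + gamma *: y], with [x] in [V]
and [y] orthogonal to [V], encodes a solution and its dual certificate as a
zero of a sum [M + C] of two monotone operators: [M] is Spingarn's partial
inverse of [gamma A] with respect to [V], whose graph is obtained from that
of [gamma A] by exchanging the components orthogonal to [V] of the argument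
and of the value, and [C = gamma *: (P \o B \o P)]. Exchanging components
preserves the scalar product of a vector of the domain with a vector of the
range and is involutive, so that [M] is maximally monotone like [A];
cocoercivity of [B] in [V] makes [C] cocoercive on the whole space, with
constant [beta / gamma]. In these terms [step1] and [step1_in] say that
[z n = P (p n) + gamma *: Q (q n)] is the value at
[s n - delta n *: C (s n)] of the resolvent of [delta n *: M], and [step2_x]
and [step2_y] amount to the relaxation
[s n.+1 = s n + lambda n *: (z n - s n)].

It remains to prove the convergence theorem [forward_backward]. The distance
from [s n] to any zero [a] never increases ([forward_backward_step]), and
the amount by which its square decreases controls both [C (s n) - C a] and
[s n - z n], which therefore tend to 0 in norm. Passing to the limit in the
monotonicity inequality of [M], where one factor converges weakly and the
other one in norm, shows that every weak limit of [s] is a zero. Opial's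
argument ([opial]) turns this into weak convergence of the whole sequence.

Weak compactness of bounded sequences is used in the following form: a
bounded sequence of reals converges along every ultrafilter, and the limits
of the [dot (s n) z] define a bounded linear form of [z], represented by a
vector ([bounded_weak_lim]). No subsequence has to be extracted, and
convergence along [\oo] is recovered from convergence along all finer
ultrafilters. The representation of linear forms and the existence of
projections both come from minimizing a quadratic functional over a closed
subspace ([riesz_on]). *)

Set Implicit Arguments.
Unset Strict Implicit.
Unset Printing Implicit Defensive.

(** * Inner products *)

Lemma cvg0_le {R : realType} {H : normedModType R} {T} (F : set_system T)
    {FF : Filter F} (f : T -> H) (g : T -> R) :
  (\forall t \near F, `|f t| <= g t) -> g t @[t --> F] --> 0 ->
  f t @[t --> F] --> 0.
Proof.
move=> fg g0; apply: norm_cvg0; apply: squeeze_cvgr (cvg_cst 0) g0.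
by apply: filterS fg => t ->; rewrite normr_ge0.
Qed.

Lemma cvg0_sqr_le {R : realType} {H : normedModType R} {T} (F : set_system T)
    {FF : Filter F} (f : T -> H) (g : T -> R) :
  (forall t, `|f t| ^+ 2 <= g t) -> g t @[t --> F] --> 0 ->
  f t @[t --> F] --> 0.
Proof.
move=> fg /cvgr0Pnorm_lt g0; apply/cvgr0Pnorm_lt => e e0.
have := g0 (e ^+ 2) (exprn_gt0 2 e0); apply: filterS => t gt.
rewrite -(@ltr_pXn2r _ 2) ?nnegrE ?normr_ge0 ?(ltW e0)//.
by apply: le_lt_trans (fg t) _; apply: le_lt_trans (ler_norm _) gt.
Qed.

Section InnerProduct.
Context (R : realType) (H : completeNormedModType R) (dot : {dot H for idfun}).
Context (dot_norm : induces_norm dot).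
Implicit Types (u v w : H) (V : set H).

Lemma dotC u v : dot u v = dot v u.
Proof. by rewrite (hermC dot) expr0 mul1r. Qed.

Lemma dotDl u v w : dot (u + v) w = dot u w + dot v w.
Proof. exact: linearDl. Qed.

Lemma dotBl u v w : dot (u - v) w = dot u w - dot v w.
Proof. exact: linearBl. Qed.

Lemma dotNl u w : dot (- u) w = - dot u w.
Proof. exact: linearNl. Qed.

Lemma dotZl a u w : dot (a *: u) w = a * dot u w.
Proof. exact: linearZl_LR. Qed.

Lemma dotDr u v w : dot w (u + v) = dot w u + dot w v.
Proof. by rewrite dotC dotDl ![dot w _]dotC. Qed.

Lemma dotBr u v w : dot w (u - v) = dot w u - dot w v.
Proof. by rewrite dotC dotBl ![dot w _]dotC. Qed.

Lemma dotNr u w : dot w (- u) = - dot w u.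
Proof. by rewrite dotC dotNl dotC. Qed.

Lemma dotZr a u w : dot w (a *: u) = a * dot w u.
Proof. by rewrite dotC dotZl dotC. Qed.

Lemma dot0l w : dot 0 w = 0.
Proof. by rewrite -(scale0r (0 : H)) dotZl mul0r. Qed.

Lemma dot0r w : dot w 0 = 0.
Proof. by rewrite dotC dot0l. Qed.

Definition dotE := (dotDl, dotBl, dotNl, dotZl, dotDr, dotBr, dotNr, dotZr,
  dot0l, dot0r).

Lemma dot_ge0 u : 0 <= dot u u.
Proof. by rewrite -dot_norm sqr_ge0. Qed.

Lemma dot_eq0 u : dot u u = 0 -> u = 0.
Proof.
by move=> u0; apply/eqP; rewrite -normr_eq0 -sqrf_eq0 dot_norm u0.
Qed.

Lemma cauchy_schwarz u v : `|dot u v| <= `|u| * `|v|.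
Proof.
rewrite -(@ler_pXn2r _ 2) ?nnegrE ?mulr_ge0//.
rewrite exprMn !dot_norm real_normK ?num_real//.
have [->|v0] := eqVneq v 0; first by rewrite !dot0r expr0n/= mulr0.
have vv : 0 < dot v v by rewrite -dot_norm exprn_gt0// normr_gt0.
(* The squared norm of this vector is [dot v v] times the defect of the
   inequality. *)
have := dot_ge0 (dot v v *: u - dot u v *: v).
rewrite !dotE (dotC v u) => h; rewrite -subr_ge0 -(pmulr_rge0 _ vv).
by apply: le_trans h _; rewrite le_eqVlt; apply/orP; left; apply/eqP; ring.
Qed.

Lemma cvg_dotl {T} (F : set_system T) {FF : Filter F} (s : T -> H) u w :
  s t @[t --> F] --> u -> dot (s t) w @[t --> F] --> dot u w.
Proof.
move=> su; apply/subr_cvg0.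
apply: (@cvg0_le _ _ _ F _ _ (fun t => `|s t - u| * `|w|)).
  by apply: nearW => t; rewrite -dotBl cauchy_schwarz.
rewrite -(mul0r `|w|); apply: cvgMr_tmp.
by rewrite -(normr0 H); apply: cvg_norm; apply/subr_cvg0.
Qed.

Lemma closed_subspaceD V u v : closed_subspace V -> V u -> V v -> V (u + v).
Proof.
move=> [[_ VP] _] Vu Vv; have := VP 1 u v; rewrite !inE scale1r; exact.
Qed.

Lemma closed_subspaceZ V a u : closed_subspace V -> V u -> V (a *: u).
Proof.
move=> [[V0 VP] _] Vu; have := VP a u 0; rewrite !inE addr0; apply => //.
by rewrite inE in V0.
Qed.

Lemma closed_subspace0 V : closed_subspace V -> V 0.
Proof. by move=> [[+ _] _]; rewrite inE. Qed.

Lemma closed_subspaceB V u v : closed_subspace V -> V u -> V v -> V (u - v).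
Proof.
move=> Vsub Vu Vv; apply: (closed_subspaceD Vsub) => //.
by rewrite -scaleN1r; exact: (closed_subspaceZ _ Vsub).
Qed.

Lemma orthD V u v : orth dot V u -> orth dot V v -> orth dot V (u + v).
Proof. by move=> Vu Vv w Vw; rewrite dotDl Vu// Vv// addr0. Qed.

Lemma orthZ V a u : orth dot V u -> orth dot V (a *: u).
Proof. by move=> Vu w Vw; rewrite dotZl Vu// mulr0. Qed.

Lemma orthB V u v : orth dot V u -> orth dot V v -> orth dot V (u - v).
Proof. by move=> Vu Vv w Vw; rewrite dotBl Vu// Vv// subrr. Qed.

(** The representer is the minimizer over [V] of [|v| ^ 2 - 2 * f v], a
quadratic functional that is bounded below; minimizing sequences are Cauchy by
the parallelogram law.  The case [f = dot u] is the projection theorem, the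
case [V = setT] is Riesz's representation theorem. *)
Lemma riesz_on V (f : H -> R) (K : R) : closed_subspace V ->
  (forall a u v, f (a *: u + v) = a * f u + f v) ->
  (forall v, `|f v| <= K * `|v|) ->
  exists2 w, V w & forall v, V v -> dot w v = f v.
Proof.
move=> Vsub flin fbnd.
have V0 : V 0 by exact: closed_subspace0.
pose J v := dot v v - 2 * f v.
pose E := [set J v | v in V].
have Elb : lbound E (- K ^+ 2).
  move=> _ [v Vv <-]; rewrite /J -dot_norm.
  have := ler_norm (f v); have := fbnd v; have := sqr_ge0 (`|v| - K); nra.
have EJ0 : E (J 0) by exists 0.
have Einf : has_inf E by split; [exists (J 0) | exists (- K ^+ 2)].
set m := inf E.
have mle v : V v -> m <= J v by move=> Vv; apply: ge_inf; [case: Einf|exists v].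
have /choice[s sP] : forall n, exists v, V v /\ J v < m + n.+1%:R^-1.
  move=> n; have n0 : 0 < n.+1%:R^-1 :> R by [].
  have [_ [v Vv <-] lt] := inf_adherent n0 Einf.
  by exists v.
have JD u t v :
    J (u + t *: v) = J u + 2 * t * (dot u v - f v) + t ^+ 2 * dot v v.
  have ftv : f (u + t *: v) = t * f v + f u by rewrite (addrC u) flin.
  by rewrite /J ftv !dotE (dotC v u); ring.
(* The parallelogram law, applied at the midpoint [u + (v - u) / 2]. *)
have Jpar u v : V u -> V v ->
    dot (u - v) (u - v) <= 2 * (J u - m) + 2 * (J v - m).
  move=> Vu Vv.
  have Vm : V (u + 2^-1 *: (v - u)).
    apply: (closed_subspaceD Vsub) => //; apply: (closed_subspaceZ _ Vsub).
    exact: closed_subspaceB.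
  have := mle _ Vm; rewrite JD.
  have -> : f (v - u) = f v - f u.
    by rewrite -scaleN1r addrC flin mulN1r addrC.
  by rewrite /J !dotE (dotC v u); lra.
have sC : cauchy_ex (s n @[n --> \oo]).
  move=> e e0.
  have e4 : 0 < e ^+ 2 / 4 by rewrite divr_gt0// exprn_gt0.
  have [N _ NP] := near_infty_natSinv_lt (PosNum e4).
  exists (s N); exists N => // n /= Nn; rewrite -ball_normE /ball_/=.
  rewrite -(@ltr_pXn2r _ 2) ?nnegrE ?(ltW e0)// dot_norm.
  have [[VN JN] [Vn Jn]] := (sP N, sP n).
  have /= eN := NP N (leqnn _); have /= en := NP n Nn.
  move: (N.+1%:R^-1) (n.+1%:R^-1) JN Jn eN en => a b JN Jn eN en.
  have := Jpar _ _ VN Vn; lra.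
have {}sC : cvg (s n @[n --> \oo]) by apply: cauchy_cvg; exact: cauchy_exP.
exists (lim (s n @[n --> \oo])).
  apply: (@closed_cvg _ _ _ _ s V _ _ _ sC); first by case: Vsub.
  by apply: nearW => n; case: (sP n).
move=> v Vv; apply/eqP; rewrite -subr_eq0; apply/eqP.
have [v0|v0] := eqVneq (dot v v) 0.
  rewrite (dot_eq0 v0) dot0r; have := flin 1 0 0.
  by rewrite scale1r addr0 mul1r; lra.
have vv : 0 < dot v v by rewrite lt_neqAle eq_sym v0 dot_ge0.
(* Along [s], comparing [J (s n)] with [J (s n + t *: v)] for the optimal [t]
   bounds the square of [dot (s n) v - f v] by [|v| ^ 2 / (n + 1)]. *)
have sc : dot (s n) v - f v @[n --> \oo] -->
    dot (lim (s n @[n --> \oo])) v - f v.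
  by apply: cvgB; [exact: cvg_dotl | exact: cvg_cst].
apply/eqP; rewrite -sqrf_eq0; apply/eqP/le_anti; rewrite sqr_ge0 andbT.
have h0 : dot v v * harmonic n @[n --> \oo] --> 0.
  by rewrite -(mulr0 (dot v v)); apply: cvgMl_tmp; exact: cvg_harmonic.
apply: (ler_cvg_to (cvgM sc sc) h0); apply: nearW => n /=.
have [Vn Jn] := sP n.
pose t := - (dot (s n) v - f v) / dot v v.
have Vt : V (s n + t *: v).
  by apply: (closed_subspaceD Vsub) => //; apply: (closed_subspaceZ _ Vsub).
have := mle _ Vt; rewrite JD.
have tv : t * dot v v = - (dot (s n) v - f v) by rewrite mulfVK.
rewrite expr2 -[t * t * _]mulrA tv => Jt.
have {}Jt : - n.+1%:R^-1 <= t * (dot (s n) v - f v).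
  move: Jn Jt; rewrite mulrN -[2 * t * _]mulrA.
  by move: (n.+1%:R^-1) (t * _) => h c; lra.
rewrite -subr_ge0.
have -> : dot v v * n.+1%:R^-1 - (dot (s n) v - f v) * (dot (s n) v - f v)
  = dot v v * n.+1%:R^-1 + (t * dot v v) * (dot (s n) v - f v).
  by rewrite tv; ring.
by rewrite (mulrC t) -mulrA -mulrDr mulr_ge0 ?(ltW vv)// addrC -lerBlDr sub0r.
Qed.

End InnerProduct.

(** * Orthogonal projections *)

Section Projections.
Context (R : realType) (H : completeNormedModType R) (dot : {dot H for idfun}).
Context (dot_norm : induces_norm dot).
Context (V : set H).
Context (V_sub : closed_subspace V).
Implicit Types (u v w x : H) (W : set H).

Let P := proj dot V.
Let Q := proj dot (orth dot V).

(** Two candidates [p] differ by a vector of [W] that is orthogonal to [W].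
The case of [orth dot V] gives its projection from that on [V]. *)
Lemma proj_unique W x p : (forall u v, W u -> W v -> W (u - v)) ->
  W p -> orth dot W (x - p) -> proj dot W x = p.
Proof.
move=> WB Wp xp; apply: xget_unique => //= q [Wq xq].
have qp : W (q - p) by exact: WB.
apply/eqP; rewrite -subr_eq0; apply/eqP/(dot_eq0 dot_norm).
have -> : dot (q - p) (q - p) = dot ((x - p) - (x - q)) (q - p).
  by rewrite opprB [in RHS](addrC (x - p)) addrA subrK.
by rewrite dotBl xp// xq// subrr.
Qed.

Lemma projP x : V (P x) /\ orth dot V (x - P x).
Proof.
have [p Vp pP] : exists2 w, V w & forall v, V v -> dot w v = dot x v.
  apply: (riesz_on dot_norm (K := `|x|)) => // [a u v|v].
    by rewrite dotDr dotZr.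
  exact: cauchy_schwarz.
have op : orth dot V (x - p) by move=> v Vv; rewrite dotBl pP// subrr.
by rewrite /P (@proj_unique V x p) // => u v; exact: closed_subspaceB.
Qed.

Lemma proj_in x : V (P x). Proof. by case: (projP x). Qed.

Lemma proj_orthE x : Q x = x - P x.
Proof.
have [Vp oxp] := projP x; apply: proj_unique => //; first exact: orthB.
by move=> v vo; rewrite opprB addrC subrK dotC vo.
Qed.

Lemma proj_orth_in x : orth dot V (Q x).
Proof. by rewrite proj_orthE; case: (projP x). Qed.

Lemma projD_orth x : P x + Q x = x.
Proof. by rewrite proj_orthE addrC subrK. Qed.

Lemma proj_sum v w : V v -> orth dot V w -> P (v + w) = v.
Proof.
move=> Vv ow; apply: proj_unique => //;
  first by move=> a b; exact: closed_subspaceB.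
by rewrite addrC addKr.
Qed.

Lemma proj_orth_sum v w : V v -> orth dot V w -> Q (v + w) = w.
Proof. by move=> Vv ow; rewrite proj_orthE proj_sum// addrC addKr. Qed.

Lemma proj_id v : V v -> P v = v.
Proof.
by move=> Vv; rewrite -[X in P X]addr0 proj_sum// => w _; rewrite dot0l.
Qed.

Lemma proj_eq0 w : orth dot V w -> P w = 0.
Proof.
move=> ow; rewrite -[w]add0r proj_sum//.
exact: closed_subspace0.
Qed.

Lemma proj_orth_eq0 v : V v -> Q v = 0.
Proof. by move=> Vv; rewrite proj_orthE proj_id// subrr. Qed.

Lemma dot_orth u v : V u -> orth dot V v -> dot u v = 0.
Proof. by move=> Vu ov; rewrite dotC ov. Qed.

Lemma projDZ a u v : P (a *: u + v) = a *: P u + P v.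
Proof.
have -> : a *: u + v = (a *: P u + P v) + (a *: Q u + Q v).
  by rewrite addrACA -scalerDr !projD_orth.
apply: proj_sum.
  apply: (closed_subspaceD V_sub); last exact: proj_in.
  by apply: (closed_subspaceZ _ V_sub); exact: proj_in.
by apply: orthD; [apply: orthZ|]; exact: proj_orth_in.
Qed.

Lemma projD u v : P (u + v) = P u + P v.
Proof. by have := projDZ 1 u v; rewrite !scale1r. Qed.

Lemma proj0 : P 0 = 0.
Proof. by apply: proj_id; exact: closed_subspace0. Qed.

Lemma projZ a u : P (a *: u) = a *: P u.
Proof. by have := projDZ a u 0; rewrite !addr0 proj0 addr0. Qed.

Lemma projB u v : P (u - v) = P u - P v.
Proof. by rewrite projD -scaleN1r projZ scaleN1r. Qed.

Lemma proj_orthB u v : Q (u - v) = Q u - Q v.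
Proof. by rewrite !proj_orthE projB !opprD !opprK addrACA. Qed.

Lemma proj_selfadjoint u v : dot (P u) v = dot u (P v).
Proof.
transitivity (dot (P u) (P v)).
  rewrite -{1}(projD_orth v) dotDr.
  by rewrite (dot_orth (proj_in u) (proj_orth_in v)) addr0.
by rewrite -{2}(projD_orth u) dotDl (proj_orth_in u (proj_in v)) addr0.
Qed.

Lemma proj_orth_selfadjoint u v : dot (Q u) v = dot u (Q v).
Proof. by rewrite !proj_orthE dotBl dotBr proj_selfadjoint. Qed.

Lemma pythagoras u : `|u| ^+ 2 = `|P u| ^+ 2 + `|Q u| ^+ 2.
Proof.
rewrite !dot_norm -{1 2}(projD_orth u) dotDl !dotDr.
rewrite (dot_orth (proj_in u) (proj_orth_in u)) addr0.
by rewrite (proj_orth_in u (proj_in u)) add0r.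
Qed.

Lemma norm_proj u : `|P u| <= `|u|.
Proof.
by rewrite -(@ler_pXn2r _ 2) ?nnegrE// (pythagoras u) lerDl sqr_ge0.
Qed.

Lemma norm_proj_orth u : `|Q u| <= `|u|.
Proof.
by rewrite -(@ler_pXn2r _ 2) ?nnegrE// (pythagoras u) lerDr sqr_ge0.
Qed.

End Projections.

(** * Weak limits along ultrafilters *)

(** If [f @^-1` A] were not in [F], its complement would have a nonempty trace
on every element of [F], and an ultrafilter containing [F] and this complement
would contradict the hypothesis. *)
Lemma cvg_of_ultra {T} {X : nbhsType} (F : set_system T) {FF : Filter F}
    (f : T -> X) (l : X) :
  (forall U, UltraFilter U -> F `<=` U -> f t @[t --> U] --> l) ->
  f t @[t --> F] --> l.
Proof.
move=> ul A lA; apply: contrapT => nFA.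
set G := within (~` (f @^-1` A)) F.
have GP : ProperFilter G.
  apply: Build_ProperFilter_ex => B GB; apply: contrapT => B0; apply: nFA.
  move: GB; rewrite /G /within /=; apply: filterS => t /= nB.
  apply: contrapT => nA.
  by apply: B0; exists t; apply: nB.
have [U [UU GU]] := ultraFilterLemma GP.
have UA : U (f @^-1` A).
  by apply: ul lA => B FB; apply: GU; rewrite /G /within /=; apply: filterS FB.
have UnA : U (~` (f @^-1` A)) by apply: GU; apply: nearW => t.
by have [t [+ +]] := filter_ex (filterI UA UnA).
Qed.

Lemma fmap_ultra {T X} (f : T -> X) (U : set_system T) :
  UltraFilter U -> UltraFilter (f @ U).
Proof.
move=> UU; split => [|G GP UG]; first exact: fmap_proper_filter.
apply/seteqP; split => [A GA|]; last exact: UG.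
have [//|UnA] := in_ultra_setVsetC (f @^-1` A) UU.
by have [x []] := filter_ex (filterI GA (UG (~` A) UnA)).
Qed.

Section WeakLimits.
Context (R : realType) (H : completeNormedModType R) (dot : {dot H for idfun}).
Context (dot_norm : induces_norm dot).
Implicit Types (u v w x : H).

(** With [\oo] for [U] this is [weak_cvg]; other filters [U] replace the
extraction of subsequences. *)
Definition weak_lim (U : set_system nat) (s : nat -> H) (l : H) : Prop :=
  forall z, dot (s n) z @[n --> U] --> dot l z.

(** Weak compactness of balls: each [dot (s n) z] stays in a segment, hence has
a limit along [U], and Riesz's theorem represents these limits by a vector. *)
Lemma bounded_weak_lim U (s : nat -> H) (K : R) : UltraFilter U ->
  (forall n, `|s n| <= K) -> exists l, weak_lim U s l.
Proof.
move=> UU sK.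
have /choice[f fP] : forall z, exists r : R, dot (s n) z @[n --> U] --> r.
  move=> z; have := @segment_compact R (- (K * `|z|)) (K * `|z|).
  rewrite compact_ultra => /(_ _ (fmap_ultra (fun n => dot (s n) z) UU)).
  case=> [|r [_ rP]]; last by exists r.
  apply: nearW => n /=; rewrite in_itv/= -ler_norml.
  by apply: le_trans (cauchy_schwarz dot_norm _ _) _; rewrite ler_wpM2r.
have [|||l _ lP] := @riesz_on _ _ _ dot_norm setT f K.
- by split; [split => [|a u v _ _]; rewrite inE | exact: closedT].
- move=> a u v.
  apply: (@norm_cvg_unique _ _ (dot (s n) (a *: u + v) @[n --> U])) => /=.
    exact: fP.
  under eq_fun do rewrite dotDr dotZr.
  by apply: cvgD; [apply: cvgMl_tmp|]; exact: fP.
- move=> v.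
  have nv : `|dot (s n) v| @[n --> U] --> `|f v| by apply: cvg_norm; exact: fP.
  apply: (ler_cvg_to nv (cvg_cst _)).
  apply: nearW => n.
  by apply: le_trans (cauchy_schwarz dot_norm _ _) _; rewrite ler_wpM2r.
- by exists l => z; rewrite lP//; exact: fP.
Qed.

Lemma weak_strong_cvg (U : set_system nat) {FU : ProperFilter U}
    (s t : nat -> H) (a b : H) (K : R) :
  (forall n, `|s n| <= K) -> weak_lim U s a -> t n @[n --> U] --> b ->
  dot (s n) (t n) @[n --> U] --> dot a b.
Proof.
move=> sK sa tb; apply/subr_cvg0.
have -> : (fun n => dot (s n) (t n) - dot a b) =
    (fun n => dot (s n) (t n - b) + (dot (s n) b - dot a b)).
  by apply/funext => n; rewrite dotBr addrA subrK.
rewrite -(addr0 (0 : R)); apply: cvgD; last by apply/subr_cvg0; exact: sa.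
apply: (@cvg0_le _ _ _ _ _ _ (fun n => K * `|t n - b|)).
  apply: nearW => n; apply: le_trans (cauchy_schwarz dot_norm _ _) _.
  by rewrite ler_wpM2r.
rewrite -(mulr0 K); apply: cvgMl_tmp.
by rewrite -(normr0 H); apply: cvg_norm; apply/subr_cvg0.
Qed.

(** For two weak limits [l] and [l'] in [S], the sequence [dot (s n) (l' - l)]
converges because it is, up to an affine map, the difference of the squared
distances to [l] and to [l'].  Its limit is [dot l (l' - l)] and
[dot l' (l' - l)], so that [l = l']. *)
Lemma opial (S : set H) (s : nat -> H) (K : R) :
  (forall n, `|s n| <= K) ->
  (forall a, S a -> cvg (`|s n - a| ^+ 2 @[n --> \oo])) ->
  (forall U l, UltraFilter U -> \oo `<=` U -> weak_lim U s l -> S l) ->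
  exists2 l, S l & weak_cvg dot s l.
Proof.
move=> sK dcvg clus.
have [U0 [UU0 U0oo]] := @ultraFilterLemma nat \oo _.
have [l sl] := bounded_weak_lim UU0 sK.
have Sl := clus _ _ UU0 U0oo sl.
exists l => // z; apply: cvg_of_ultra => U UU Uoo.
have [l' sl'] := bounded_weak_lim UU sK.
have Sl' := clus _ _ UU Uoo sl'.
suff <- : l' = l by exact: sl'.
have : cvg (dot (s n) (l' - l) @[n --> \oo]).
  have -> : (fun n => dot (s n) (l' - l)) = (fun n => 2^-1 *
      (`|s n - l| ^+ 2 - `|s n - l'| ^+ 2 - (dot l l - dot l' l'))).
    apply/funext => n; rewrite !dot_norm !dotE (dotC dot l) (dotC dot l'); lra.
  apply: is_cvgMl_tmp; apply: is_cvgB; last exact: is_cvg_cst.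
  by apply: is_cvgB; exact: dcvg.
move=> /cvg_ex[r rP].
have r0 : dot l (l' - l) = r.
  apply: (@norm_cvg_unique _ _ (dot (s n) (l' - l) @[n --> U0])) => //=.
  by move=> A rA; apply: U0oo; exact: rP.
have r1 : dot l' (l' - l) = r.
  apply: (@norm_cvg_unique _ _ (dot (s n) (l' - l) @[n --> U])) => //=.
  by move=> A rA; apply: Uoo; exact: rP.
apply/eqP; rewrite -subr_eq0; apply/eqP/(dot_eq0 dot_norm).
by rewrite dotBl r0 r1 subrr.
Qed.

End WeakLimits.

(** * The forward-backward iteration *)

Section ForwardBackward.
Context (R : realType) (H : completeNormedModType R) (dot : {dot H for idfun}).
Context (dot_norm : induces_norm dot).
Implicit Types (u v w x : H) (M : H -> set H) (C : H -> H).

(** Otherwise the graph of [M] could be enlarged by the pair [(x, u)]. *)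
Lemma maximally_monotone_in M x u : maximally_monotone dot M ->
  (forall y v, M y v -> 0 <= dot (x - y) (u - v)) -> M x u.
Proof.
move=> [Mmono Mmax] xu.
pose M' y := M y `|` [set v | y = x /\ v = u].
apply: (Mmax M') => [y z v w|y v Mv|]; [|by left|by right].
move=> [Mv|[-> ->]] [Mw|[-> ->]]; [exact: Mmono| |exact: xu|
  by rewrite subrr dot0l].
by rewrite -(opprB x) -(opprB u) dotNl dotNr opprK; exact: xu.
Qed.

(** Here [z] stands for the resolvent of [d *: M] at [s - d *: c] and [a]
for a zero, with [c] and [c'] the values of [C] at [s] and [a]. Expanding
[|s - a| ^ 2] around [z - a], monotonicity bounds the cross product
[dot (z - a) (s - z)] from below by [d * dot (z - a) (c - c')]. Once [z - a]
is split into [s - a] and [z - s], cocoercivity bounds the first part and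
the second one completes the square. *)
Lemma forward_backward_step (kappa d : R) (s z a c c' : H) : 0 < d ->
  kappa * `|c - c'| ^+ 2 <= dot (s - a) (c - c') ->
  0 <= dot (z - a) (d^-1 *: (s - d *: c - z) - - c') ->
  `|z - a| ^+ 2 <= `|s - a| ^+ 2 - `|(s - z) - d *: (c - c')| ^+ 2
    - d * (2 * kappa - d) * `|c - c'| ^+ 2.
Proof.
move=> d0; set D := c - c' => coco mono.
have sdD : (s - z) - d *: D = d *: (d^-1 *: (s - d *: c - z) - - c').
  rewrite [- - c']opprK [RHS]scalerDr scalerA mulfV ?gt_eqF// scale1r /D.
  rewrite scalerBr opprB.
  by rewrite (addrAC s (- (d *: c))) -[RHS]addrA (addrC (- _) (d *: c')).
have {}mono : 0 <= dot (z - a) ((s - z) - d *: D).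
  by rewrite sdD dotZr mulr_ge0 ?(ltW d0).
have {}coco : 0 <= d * (dot (s - a) D - kappa * `|D| ^+ 2).
  by rewrite mulr_ge0 ?(ltW d0)// subr_ge0.
rewrite !dot_norm in coco *.
move: mono coco {sdD}; have -> : z - a = (s - a) - (s - z).
  by rewrite opprB [RHS]addrC addrA subrK.
move: (s - a) (s - z) D => p e D.
by rewrite !dotE ?(dotC dot e p) ?(dotC dot D p) ?(dotC dot D e); lra.
Qed.

Lemma sqr_norm_convex (t : R) u v : 0 <= t <= 1 ->
  `|u + t *: (v - u)| ^+ 2 <= (1 - t) * `|u| ^+ 2 + t * `|v| ^+ 2.
Proof.
move=> /andP[t0 t1].
have : 0 <= t * (1 - t) * `|v - u| ^+ 2.
  by rewrite mulr_ge0 ?sqr_ge0// mulr_ge0// subr_ge0.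
by rewrite !dot_norm !dotE (dotC dot v u); lra.
Qed.

Section Algorithm.
Context (M : H -> set H) (C : H -> H) (kappa eps : R).
Context (delta lambda : nat -> R) (s z : nat -> H).
Context (M_max : maximally_monotone dot M).
Context (kappa_gt0 : 0 < kappa).
Context (C_coco : cocoercive_in dot setT kappa C).
Context (eps_gt0 : 0 < eps).
Context (delta_in : forall n, eps <= delta n <= 2 * kappa - eps).
Context (lambda_in : forall n, eps <= lambda n <= 1).
Context (step_z : forall n,
  M (z n) ((delta n)^-1 *: (s n - delta n *: C (s n) - z n))).
Context (step_s : forall n, s n.+1 = s n + lambda n *: (z n - s n)).

Let zer := [set a | M a (- C a)].

Let delta_gt0 n : 0 < delta n.
Proof. by case/andP: (delta_in n) => + _; exact: lt_le_trans. Qed.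

(** What [forward_backward_step] guarantees, uniformly in the step size, about
the decrease of the squared distance to [a] from [s n] to [z n]: the two factors
of [delta n * (2 * kappa - delta n)] are at least [eps]. *)
Let decrement a n := `|(s n - z n) - delta n *: (C (s n) - C a)| ^+ 2
  + eps ^+ 2 * `|C (s n) - C a| ^+ 2.

Let decrement_ge0 a n : 0 <= decrement a n.
Proof. by rewrite /decrement addr_ge0 ?sqr_ge0// -exprMn sqr_ge0. Qed.

Let fejer_z a n : zer a -> `|z n - a| ^+ 2 <= `|s n - a| ^+ 2 - decrement a n.
Proof.
move=> aZ.
have := @forward_backward_step kappa (delta n) (s n) (z n) a (C (s n)) (C a)
  (delta_gt0 n) (C_coco I I) (M_max.1 _ _ _ _ (step_z n) aZ).
move=> /le_trans; apply; rewrite /decrement opprD addrA lerD2l lerN2.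
apply: ler_wpM2r; first exact: sqr_ge0.
have /andP[d1 d2] := delta_in n.
by rewrite expr2; apply: ler_pM; rewrite ?(ltW eps_gt0)//; lra.
Qed.

Let fejer_s a n : zer a ->
  `|s n.+1 - a| ^+ 2 <= `|s n - a| ^+ 2 - eps * decrement a n.
Proof.
move=> aZ; have /andP[l1 l2] := lambda_in n.
have l0 : 0 <= lambda n by apply: le_trans l1; exact: ltW.
have -> : s n.+1 - a = (s n - a) + lambda n *: ((z n - a) - (s n - a)).
  by rewrite step_s opprB addrA subrK addrAC.
apply: le_trans (sqr_norm_convex _ _ _) _; first by rewrite l0.
have := fejer_z n aZ; have := decrement_ge0 a n; nra.
Qed.

Let decr_s a n : zer a -> `|s n.+1 - a| ^+ 2 <= `|s n - a| ^+ 2.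
Proof.
move=> aZ; apply: le_trans (fejer_s n aZ) _.
by rewrite gerDl oppr_le0 mulr_ge0// ltW.
Qed.

Let dist_cvg a : zer a -> cvg (`|s n - a| ^+ 2 @[n --> \oo]).
Proof.
move=> aZ; apply: nonincreasing_is_cvgn.
  by apply/nonincreasing_seqP => n; exact: decr_s.
by exists 0 => _ [n _ <-]; exact: sqr_ge0.
Qed.

Let decrement_cvg0 a : zer a -> decrement a n @[n --> \oo] --> 0.
Proof.
move=> aZ; have /cvg_ex[r rP] := dist_cvg aZ.
apply: (@cvg0_le _ _ _ _ _ _
  (fun n => eps^-1 * (`|s n - a| ^+ 2 - `|s n.+1 - a| ^+ 2))).
  apply: nearW => n; rewrite ger0_norm// mulrC ler_pdivlMr// mulrC.
  by rewrite lerBrDr -lerBrDl; exact: fejer_s.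
rewrite -(mulr0 eps^-1); apply: cvgMl_tmp; rewrite -(subrr r).
apply: cvgB => //; move: rP.
by rewrite -(cvg_shiftS (fun n => `|s n - a| ^+ 2)).
Qed.

(** As this holds for every zero, [C] is constant on the set of zeros. *)
Let C_cvg a : zer a -> C (s n) @[n --> \oo] --> C a.
Proof.
move=> aZ; apply/subr_cvg0.
apply: (@cvg0_sqr_le _ _ _ _ _ _ (fun n => eps^-1 ^+ 2 * decrement a n)).
  move=> n; rewrite exprVn mulrC ler_pdivlMr ?exprn_gt0// mulrC /decrement.
  by rewrite lerDr sqr_ge0.
rewrite -(mulr0 (eps^-1 ^+ 2)); apply: cvgMl_tmp; exact: decrement_cvg0.
Qed.

Let residual_cvg0 : zer !=set0 -> s n - z n @[n --> \oo] --> 0.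
Proof.
move=> [a aZ].
have r0 : (s n - z n) - delta n *: (C (s n) - C a) @[n --> \oo] --> 0.
  apply: (@cvg0_sqr_le _ _ _ _ _ _ (decrement a)); last exact: decrement_cvg0.
  by move=> n; rewrite /decrement lerDl -exprMn sqr_ge0.
have D0 : delta n *: (C (s n) - C a) @[n --> \oo] --> 0.
  apply: (@cvg0_le _ _ _ _ _ _ (fun n => (2 * kappa) * `|C (s n) - C a|)).
    apply: nearW => n; rewrite normrZ ler_wpM2r// gtr0_norm//.
    by have /andP[_ ] := delta_in n; have := eps_gt0; lra.
  rewrite -(mulr0 (2 * kappa)); apply: cvgMl_tmp.
  by rewrite -(normr0 H); apply: cvg_norm; apply/subr_cvg0; exact: C_cvg.
have -> : (fun n => s n - z n) = (fun n => (s n - z n -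
    delta n *: (C (s n) - C a)) + delta n *: (C (s n) - C a)).
  by apply/funext => n; rewrite subrK.
by rewrite -(addr0 (0 : H)); exact: cvgD.
Qed.

(** The element of [M (z n)] given by [step_z] tends to [- C a] in norm and
[z n] tends to [l] weakly, hence [(l, - C a)] is in the graph of [M] by
maximality; and cocoercivity, between [s n] and [l], forces [C l = C a]. *)
Let weak_lim_zer a K : zer a ->
  (forall n, `|s n| <= K) -> (forall n, `|z n| <= K) ->
  forall U l, UltraFilter U -> \oo `<=` U -> weak_lim dot U s l -> zer l.
Proof.
move=> aZ sK zK U l UU Uoo sl.
have e0 : s n - z n @[n --> U] --> 0.
  by move=> A /(residual_cvg0 (ex_intro _ _ aZ)); exact: Uoo.
have Ca : C (s n) @[n --> U] --> C a by move=> A /(C_cvg aZ); exact: Uoo.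
have zl : weak_lim dot U z l.
  move=> y; have -> : (fun n => dot (z n) y) =
      (fun n => dot (s n) y - dot (s n - z n) y).
    by apply/funext => n; rewrite -dotBl opprB addrC subrK.
  have -> : dot l y = dot l y - dot 0 y by rewrite dot0l subr0.
  by apply: cvgB; [exact: sl | exact: cvg_dotl].
have wa : (delta n)^-1 *: (s n - delta n *: C (s n) - z n) @[n --> U] --> - C a.
  have -> : (fun n => (delta n)^-1 *: (s n - delta n *: C (s n) - z n)) =
      (fun n => (delta n)^-1 *: (s n - z n) - C (s n)).
    apply/funext => n; rewrite addrAC scalerBr scalerA mulVf ?scale1r//.
    by rewrite gt_eqF.
  rewrite -(add0r (- C a)); apply: cvgB => //.
  apply: (@cvg0_le _ _ _ _ _ _ (fun n => eps^-1 * `|s n - z n|)).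
    apply: nearW => n; rewrite normrZ ler_wpM2r//.
    rewrite ger0_norm ?invr_ge0 ?(ltW (delta_gt0 n))//.
    by rewrite lef_pV2 ?posrE//; case/andP: (delta_in n).
  rewrite -(mulr0 eps^-1); apply: cvgMl_tmp.
  by rewrite -(normr0 H); exact: cvg_norm.
have Cl : C l = C a.
  have lhs : kappa * (`|C (s n) - C l| * `|C (s n) - C l|) @[n --> U]
      --> kappa * (`|C a - C l| * `|C a - C l|).
    apply: cvgMl_tmp.
    by apply: cvgM; apply: cvg_norm; apply: cvgB => //; exact: cvg_cst.
  have rhs : dot (s n) (C (s n) - C l) - dot l (C (s n) - C l) @[n --> U] -->
      dot l (C a - C l) - dot l (C a - C l).
    have CCl : C (s n) - C l @[n --> U] --> C a - C l.
      by apply: cvgB => //; exact: cvg_cst.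
    apply: cvgB; first exact: (weak_strong_cvg dot_norm sK).
    under eq_fun do rewrite dotC.
    by rewrite dotC; exact: cvg_dotl.
  rewrite subrr in rhs.
  have : kappa * (`|C a - C l| * `|C a - C l|) <= 0.
    apply: (ler_cvg_to lhs rhs); apply: nearW => n.
    by rewrite -dotBl -expr2; exact: C_coco.
  rewrite pmulr_rle0// -expr2 => Cl0; apply/esym/eqP.
  by rewrite -subr_eq0 -normr_eq0 -sqrf_eq0 eq_le Cl0 sqr_ge0.
rewrite /zer /= Cl; apply: maximally_monotone_in => // y v Mv.
have zy : weak_lim dot U (fun n => z n - y) (l - y).
  move=> t; rewrite dotBl; under eq_fun do rewrite dotBl.
  by apply: cvgB; [exact: zl | exact: cvg_cst].
have zyK n : `|z n - y| <= K + `|y|.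
  by apply: le_trans (ler_normB _ _) _; rewrite lerD2r.
have wv : (delta n)^-1 *: (s n - delta n *: C (s n) - z n) - v @[n --> U]
    --> - C a - v.
  by apply: cvgB => //; exact: cvg_cst.
apply: (cvgr_to_ge (weak_strong_cvg dot_norm zyK zy wv)).
by apply: nearW => n; exact: M_max.1.
Qed.

Theorem forward_backward : zer !=set0 ->
  exists l, [/\ M l (- C l), weak_cvg dot s l,
    s n.+1 - s n @[n --> \oo] --> 0 & C (s n) @[n --> \oo] --> C l].
Proof.
move=> [a aZ].
have sa n : `|s n - a| <= `|s 0%N - a|.
  rewrite -(@ler_pXn2r _ 2) ?nnegrE//.
  by elim: n => // n; apply: le_trans; exact: decr_s.
have za n : `|z n - a| <= `|s 0%N - a|.
  apply: le_trans (sa n); rewrite -(@ler_pXn2r _ 2) ?nnegrE//.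
  by apply: le_trans (fejer_z n aZ) _; rewrite gerDl oppr_le0.
have bnd t : `|t - a| <= `|s 0%N - a| -> `|t| <= `|s 0%N - a| + `|a|.
  move=> ta; rewrite -{1}(subrK a t).
  by apply: le_trans (ler_normD _ _) _; rewrite lerD2r.
have [l lZ sl] := opial dot_norm (fun n => bnd _ (sa n)) dist_cvg
  (weak_lim_zer aZ (fun n => bnd _ (sa n)) (fun n => bnd _ (za n))).
exists l; split => //; last exact: C_cvg.
apply: (@cvg0_le _ _ _ _ _ _ (fun n => `|s n - z n|)).
  apply: nearW => n; rewrite step_s addrC addKr normrZ distrC ler_piMl//.
  have /andP[l1 l2] := lambda_in n.
  by rewrite ger0_norm// (le_trans (ltW eps_gt0)).
by rewrite -(normr0 H); apply: cvg_norm; apply: residual_cvg0; exists a.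
Qed.

End Algorithm.
End ForwardBackward.

(** * Partial inverses *)

Section PartialInverse.
Context (R : realType) (H : completeNormedModType R) (dot : {dot H for idfun}).
Context (dot_norm : induces_norm dot).
Context (V : set H).
Context (V_sub : closed_subspace V).
Implicit Types (A M : H -> set H).

Local Notation P := (proj dot V).
Local Notation Q := (proj dot (orth dot V)).

(** The operator [g A], whose values are the sets [g *: A x]. *)
Definition scale_op (g : R) A : H -> set H :=
  fun x => [set u | A x (g^-1 *: u)].

(** Spingarn's partial inverse: [(P x + Q u, P u + Q x)] is in its graph when
[(x, u)] is in the graph of [A].  It is [A] for [V = setT] and the inverse
of [A] for [V = [set 0]]. *)
Definition partial_inverse A : H -> set H :=
  fun z => [set w | A (P z + Q w) (P w + Q z)].

Lemma maximally_monotone_scale g A : 0 < g ->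
  maximally_monotone dot A -> maximally_monotone dot (scale_op g A).
Proof.
move=> g0 [Am Amax].
have mono h A' : 0 < h ->
    monotone dot A' -> monotone dot (scale_op h A').
  move=> h0 A'm x y u v xu yv; have := A'm _ _ _ _ xu yv.
  by rewrite -scalerBr dotZr pmulr_rge0 ?invr_gt0.
split => [|A' A'm AA' x u A'xu]; first exact: mono.
apply: (Amax (scale_op g^-1 A')) => [|y v Ayv|].
- by apply: mono; rewrite ?invr_gt0.
- by apply: AA'; rewrite /scale_op/= invrK scalerA mulVf ?scale1r ?gt_eqF.
- by rewrite /scale_op/= invrK scalerA mulfV ?scale1r ?gt_eqF.
Qed.

Lemma proj_swap z w : P (P z + Q w) + Q (P w + Q z) = z.
Proof.
have [Vz Vw] := (proj_in dot_norm V_sub z, proj_in dot_norm V_sub w).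
have [oz ow] := (proj_orth_in dot_norm V_sub z, proj_orth_in dot_norm V_sub w).
rewrite (proj_sum dot_norm V_sub Vz ow) (proj_orth_sum dot_norm V_sub Vw oz).
exact: projD_orth.
Qed.

Lemma partial_inverseK A z : partial_inverse (partial_inverse A) z = A z.
Proof. by apply/seteqP; split=> w; rewrite /partial_inverse/= !proj_swap. Qed.

(** The isometry [(z, w) |-> (P z + Q w, P w + Q z)] of the product space
preserves the duality product; as it is linear, it preserves monotonicity. *)
Lemma dot_swap z w : dot (P z + Q w) (P w + Q z) = dot z w.
Proof.
have [Vz Vw] := (proj_in dot_norm V_sub z, proj_in dot_norm V_sub w).
have [oz ow] := (proj_orth_in dot_norm V_sub z, proj_orth_in dot_norm V_sub w).
rewrite -{3}(projD_orth dot_norm V_sub z) -{3}(projD_orth dot_norm V_sub w).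
rewrite !dotDl !dotDr (ow _ Vw) (dot_orth Vz oz) (oz _ Vw).
by rewrite (dot_orth Vz ow) (dotC dot (Q w)) !addr0 !add0r.
Qed.

Lemma monotone_partial_inverse A :
  monotone dot A -> monotone dot (partial_inverse A).
Proof.
move=> Am z z' w w' zw zw'; have := Am _ _ _ _ zw zw'.
rewrite !opprD addrACA [X in dot _ X]addrACA.
by rewrite -!(projB dot_norm V_sub) -!(proj_orthB dot_norm V_sub) dot_swap.
Qed.

(** Partial inversion is an involution that preserves monotonicity and
inclusion of graphs, hence it preserves maximality. *)
Lemma maximally_monotone_partial_inverse A :
  maximally_monotone dot A -> maximally_monotone dot (partial_inverse A).
Proof.
move=> [Am Amax]; split=> [|M Mm AM z w Mzw].
  exact: monotone_partial_inverse.
have MA : forall x, partial_inverse M x `<=` A x.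
  apply: Amax; first exact: monotone_partial_inverse.
  by move=> x u; rewrite -{1}partial_inverseK; exact: AM.
by apply: MA; rewrite /partial_inverse/= !proj_swap.
Qed.

Lemma cocoercive_proj (beta g : R) (B : H -> H) : 0 < beta -> 0 < g ->
  cocoercive_in dot V beta B ->
  cocoercive_in dot setT (beta / g) (fun u => g *: P (B (P u))).
Proof.
move=> beta0 g0 B_coco u v _ _; set b := B (P u) - B (P v).
rewrite -scalerBr -(projB dot_norm V_sub) -/b dotZr normrZ gtr0_norm//.
rewrite -(proj_selfadjoint dot_norm V_sub) (projB dot_norm V_sub).
have PV x : V (P x) by exact: proj_in.
have := B_coco (P u) (P v) (PV u) (PV v).
rewrite -/b => coco.
have -> : beta / g * (g * `|P b|) ^+ 2 = g * (beta * `|P b| ^+ 2).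
  by field; rewrite gt_eqF.
rewrite ler_pM2l//; apply: le_trans coco; rewrite ler_pM2l//.
by rewrite ler_pXn2r ?nnegrE//; exact: norm_proj.
Qed.

(** A zero [l] of [partial_inverse (scale_op g A) + g *: (P \o B \o P)] encodes
a solution [P l] together with its dual certificate [g^-1 *: Q l]. *)
Lemma partial_inverse_zero (g : R) A (B : H -> H) l : 0 < g ->
  partial_inverse (scale_op g A) l (- (g *: P (B (P l)))) <->
  A (P l) (g^-1 *: Q l - P (B (P l))).
Proof.
move=> g0; set b := P (B (P l)).
have Vb : V (- (g *: b)).
  rewrite -scaleNr; apply: (closed_subspaceZ _ V_sub).
  exact: (proj_in dot_norm V_sub).
rewrite /partial_inverse /scale_op/= (proj_orth_eq0 dot_norm V_sub Vb).
rewrite (proj_id dot_norm V_sub Vb).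
rewrite addr0 scalerDr scalerN scalerA mulVf ?gt_eqF// scale1r addrC.
by [].
Qed.

End PartialInverse.

(** * Convergence of the splitting algorithm *)

Theorem theorem5p3 (R : realType) (H : completeNormedModType R)
  (dot : {dot H for idfun}) (dot_norm : induces_norm dot)
  (V : set H) (V_sub : closed_subspace V)
  (A : H -> set H) (A_max : maximally_monotone dot A)
  (beta : R) (beta_gt0 : 0 < beta)
  (B : H -> H) (B_coco : cocoercive_in dot V beta B)
  (sol_neq0 : solutions dot V A B !=set0)
  (gamma : R) (gamma_gt0 : 0 < gamma)
  (eps : R) (eps_gt0 : 0 < eps) (eps_lt : eps < Num.max 1 (beta / gamma))
  (delta : nat -> R)
  (delta_in : forall n, eps <= delta n <= 2 * beta / gamma - eps)
  (lambda : nat -> R) (lambda_in : forall n, eps <= lambda n <= 1)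
  (x y p q : nat -> H)
  (x0_in : V (x 0%N)) (y0_in : orth dot V (y 0%N))
  (step1 : forall n,
     x n - (delta n * gamma) *: proj dot V (B (x n)) + gamma *: y n
       = p n + gamma *: q n)
  (step1_in : forall n,
     A (proj dot V (p n) + (delta n)^-1 *: proj dot (orth dot V) (p n))
       ((delta n)^-1 *: proj dot V (q n) + proj dot (orth dot V) (q n)))
  (step2_x : forall n,
     x n.+1 = x n + lambda n *: (proj dot V (p n) - x n))
  (step2_y : forall n,
     y n.+1 = y n + lambda n *: (proj dot (orth dot V) (q n) - y n)) :
  (forall n, V (x n)) /\
  (forall n, orth dot V (y n)) /\
  exists xbar ybar : H,
    [/\ solutions dot V A B xbar,
        (orth dot V `&` [set a + proj dot V (B xbar) | a in A xbar]) ybar &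
        [/\ weak_cvg dot x xbar /\ weak_cvg dot y ybar,
            (x n.+1 - x n @[n --> \oo] --> (0 : H)) /\
            (y n.+1 - y n @[n --> \oo] --> (0 : H)) &
            proj dot V (B (x n)) @[n --> \oo] --> proj dot V (B xbar)]].
Proof.
pose P := proj dot V; pose Q := proj dot (orth dot V).
pose M := partial_inverse dot V (scale_op gamma A).
pose C u := gamma *: P (B (P u)).
pose s n := x n + gamma *: y n; pose z n := P (p n) + gamma *: Q (q n).
have PV u : V (P u) by exact: proj_in.
have QV u : orth dot V (Q u) by exact: proj_orth_in.
have delta_gt0 n : 0 < delta n.
  by case/andP: (delta_in n) => + _; exact: lt_le_trans.
have xV n : V (x n).
  elim: n => // n Vx; rewrite step2_x; apply: (closed_subspaceD V_sub) => //.
  apply: (closed_subspaceZ _ V_sub).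
  exact: (closed_subspaceB V_sub).
have yV n : orth dot V (y n).
  elim: n => // n Vy; rewrite step2_y; apply: orthD => //.
  by apply: orthZ; exact: orthB.
have Ps n : P (s n) = x n by apply: proj_sum => //; exact: orthZ.
have Qs n : Q (s n) = gamma *: y n by apply: proj_orth_sum => //; exact: orthZ.
have Pz n : P (z n) = P (p n) by apply: proj_sum => //; exact: orthZ.
have Qz n : Q (z n) = gamma *: Q (q n).
  by apply: proj_orth_sum => //; exact: orthZ.
have C_coco : cocoercive_in dot setT (beta / gamma) C by exact: cocoercive_proj.
have M_max : maximally_monotone dot M.
  apply: maximally_monotone_partial_inverse => //.
  exact: maximally_monotone_scale.
have delta_in' n : eps <= delta n <= 2 * (beta / gamma) - eps.
  by rewrite mulrA.
have step_s n : s n.+1 = s n + lambda n *: (z n - s n).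
  rewrite /s /z step2_x step2_y -/P -/Q (scalerDr gamma) addrACA; congr (_ + _).
  rewrite scalerA (mulrC gamma) -scalerA -scalerDr opprD addrACA.
  by rewrite (scalerBr gamma).
have step_z n : M (z n) ((delta n)^-1 *: (s n - delta n *: C (s n) - z n)).
  have -> : s n - delta n *: C (s n) - z n = gamma *: P (q n) + Q (p n).
    rewrite /C Ps scalerA /s (addrAC (x n)) step1 /z.
    rewrite -{1}(projD_orth dot_norm V_sub (p n)) -/P -/Q.
    rewrite -{1}(projD_orth dot_norm V_sub (q n)) -/P -/Q scalerDr.
    by rewrite opprD addrACA addrK (addrC (P _)) addrK addrC.
  have Vp : V ((delta n)^-1 *: (gamma *: P (q n))).
    by do 2!apply: (closed_subspaceZ _ V_sub).
  have Vq : orth dot V ((delta n)^-1 *: Q (p n)) by exact: orthZ.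
  rewrite scalerDr /M /partial_inverse /scale_op /=.
  have -> := proj_sum dot_norm V_sub Vp Vq.
  have -> := proj_orth_sum dot_norm V_sub Vp Vq; rewrite -/P -/Q Pz Qz.
  rewrite scalerDr !scalerA mulrAC mulVf ?gt_eqF// mul1r scale1r.
  exact: step1_in.
have zerE l : M l (- C l) <-> A (P l) (gamma^-1 *: Q l - P (B (P l))).
  exact: partial_inverse_zero.
(* The multiplier of a solution [xs] with [a + B xs + u = 0] is [Q a]: the
   component of this equation in [V] gives [P a = - P (B xs)]. *)
have [|l [Ml sl ds Cs]] := forward_backward dot_norm M_max
    (divr_gt0 beta_gt0 gamma_gt0) C_coco eps_gt0 delta_in' lambda_in
    step_z step_s.
  have [xs [a Axa [u [Vxs ou] /esym aBu]]] := sol_neq0.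
  have oQ : orth dot V (gamma *: Q a) by exact: orthZ.
  exists (xs + gamma *: Q a); apply/zerE.
  have -> : P (xs + gamma *: Q a) = xs by exact: proj_sum.
  have -> : Q (xs + gamma *: Q a) = gamma *: Q a by exact: proj_orth_sum.
  rewrite scalerA mulVf ?gt_eqF// scale1r.
  suff <- : a = Q a - P (B xs) by [].
  have : P (a + B xs + u) = 0 by rewrite -aBu; exact: proj0.
  rewrite /P /Q !projD// (proj_eq0 dot_norm V_sub ou) addr0 => /addr0_eq <-.
  by rewrite opprK addrC projD_orth.
have PC u : P (B (P u)) = gamma^-1 *: C u.
  by rewrite scalerA mulVf ?gt_eqF// scale1r.
split=> //; split=> //; exists (P l), (gamma^-1 *: Q l).
move/zerE: Ml => Al; split.
- exists (gamma^-1 *: Q l - P (B (P l))) => //.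
  exists (- (gamma^-1 *: Q l) - Q (B (P l))).
    by split=> //; apply: orthB => //; rewrite -scaleNr; exact: orthZ.
  rewrite addrAC addrACA subrr add0r -opprD projD_orth//.
  by rewrite addrC subrr.
- split; first exact: orthZ.
  by exists (gamma^-1 *: Q l - P (B (P l))) => //; rewrite subrK.
- split; [split|split|].
  + move=> w; rewrite proj_selfadjoint//.
    under eq_fun do rewrite -Ps proj_selfadjoint//.
    exact: sl.
  + move=> w; rewrite dotZl proj_orth_selfadjoint//.
    have -> : (fun n => dot (y n) w) = (fun n => gamma^-1 * dot (s n) (Q w)).
      apply/funext => n; rewrite -proj_orth_selfadjoint// -/Q Qs dotZl mulrA.
      by rewrite mulVf ?gt_eqF// mul1r.
    by apply: cvgMl_tmp; exact: sl.
  + apply: (@cvg0_le _ _ _ _ _ _ (fun n => `|s n.+1 - s n|)).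
      apply: nearW => n; rewrite -!Ps -projB//; exact: norm_proj.
    by rewrite -(normr0 H); exact: cvg_norm.
  + apply: (@cvg0_le _ _ _ _ _ _ (fun n => gamma^-1 * `|s n.+1 - s n|)).
      apply: nearW => n; rewrite -ler_pdivrMl ?invr_gt0// invrK.
      rewrite -[X in X * _]gtr0_norm// -normrZ scalerBr -!Qs -proj_orthB//.
      exact: norm_proj_orth.
    rewrite -(mulr0 gamma^-1); apply: cvgMl_tmp.
    by rewrite -(normr0 H); exact: cvg_norm.
  + rewrite -/P PC.
    have -> : (fun n => P (B (x n))) = (fun n => gamma^-1 *: C (s n)).
      by apply/funext => n; rewrite -PC Ps.
    exact: cvgZl_tmp.
Qed.
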